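(* Let $f:[0,\infty)\to\mathbb{R}$ be a function that is differentiable on $(0,\infty)$, let $0<a<b$, and suppose $f'\in L[a,b]$. Let $s\in(0,1]$ be fixed and let $q>1$. If $|f'|^q$ is $s$-convex in the second sense on $[a,b]$, then $$\left|\frac{1}{b-a}\int_a^b f(x)\,dx-\frac12\left(\frac{b f(a)-a f(b)}{b-a}+f\left(\frac{a+b}{2}\right)\right)\right|$$ $$\le \frac{A^{1-\frac1q}(a,b)}{\left(2^{2q+s}(s+1)(s+2)\right)^{1/q}}\Big\{\left[(as+a+b)|f'(b)|^q+\left(b\left(s2^{s+1}+1\right)+a\left(2^{s+2}-s-3\right)\right)|f'(a)|^q\right]^{1/q}$$ $$+\left[(bs+b+a)|f'(a)|^q+\left(a\left(s2^{s+1}+1\right)+b\left(2^{s+2}-s-3\right)\right)|f'(b)|^q\right]^{1/q}\Big\}.$$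
   Context: For $s\in(0,1]$, a function $\varphi$ with values in $[0,\infty)$ is $s$-convex in the second sense on an interval $I\subseteq[0,\infty)$ if $\varphi(tx+(1-t)y)\le t^s\varphi(x)+(1-t)^s\varphi(y)$ for all $x,y\in I$ and all $t\in[0,1]$. $L[a,b]$ denotes the (Lebesgue) integrable functions on $[a,b]$. $A(a,b)=\frac{a+b}{2}$ is the arithmetic mean and $A^{r}(a,b)=(A(a,b))^{r}$. *)

(* Defs.v *)
From HB Require Import structures.
From mathcomp Require Import all_boot all_order all_algebra.
From mathcomp Require Import all_classical all_reals all_analysis.

Set Implicit Arguments.
Unset Strict Implicit.
Unset Printing Implicit Defensive.

Import Order.TTheory GRing.Theory Num.Theory.
Import numFieldNormedType.Exports.

Local Open Scope classical_set_scope.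
Local Open Scope ring_scope.

(* The first clause says that [phi] takes values in [0, +oo[ on [I].  The notion
   is meant for 0 < s <= 1 and an interval [I] included in [0, +oo[; since
   s != 0, the library convention 0 `^ s = 0 is the usual one at the endpoints
   t = 0 and t = 1. *)
Definition s_convex_second {R : realType} (s : R) (I : set R)
    (phi : R -> R) : Prop :=
  (forall x : R, I x -> 0 <= phi x) /\
  (forall x y t : R, I x -> I y -> 0 <= t <= 1 ->
     phi (t * x + (1 - t) * y) <= t `^ s * phi x + (1 - t) `^ s * phi y).

Definition arith_mean {R : realType} (a b : R) : R := (a + b) / 2.

(* Main.v *)
Require Import Defs.
From HB Require Import structures.
From mathcomp Require Import all_boot all_order all_algebra.
From mathcomp Require Import all_classical all_reals all_analysis.
From mathcomp Require Import ring lra.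

Set Implicit Arguments.
Unset Strict Implicit.
Unset Printing Implicit Defensive.

Import Order.TTheory GRing.Theory Num.Theory.
Import numFieldNormedType.Exports.

Local Open Scope ring_scope.
Local Open Scope classical_set_scope.

(** Write [p = 1/q], [m = (a + b) / 2], and let [F] be a primitive of [f] on
    [[a, b]].  Since [((c - x) f(x) + F(x))' = (c - x) f'(x)], integrating by
    parts with [c = a + b/2] on [[a, m]] and [c = b + a/2] on [[m, b]] turns the
    quantity under the absolute value into [(b - a)^-1] times
      [int_a^m (a + b/2 - x) f'(x) dx + int_m^b (b + a/2 - x) f'(x) dx],
    with nonnegative kernels of mass [(b - a)(a + b)/8] each.  The power mean
    inequality [int k |f'| <= (int k)^(1 - p) (int k |f'|^q)^p], followed by
    [|f'(x)|^q <= (1 - t)^s |f'(a)|^q + t^s |f'(b)|^q] at [x = a + t (b - a)],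
    leaves integrals of [t^s] and [(1 - t)^s] against affine functions, which
    produce the stated coefficients.

    The derivative [f'] need not be continuous, so it is never integrated: every
    integral above is replaced by the increment of a function with a known
    derivative.  Comparison of derivatives through the mean value theorem
    ([norm_sub_le_antiderivative]) replaces monotonicity of the integral, and
    the tangent line of the concave function [w |-> w^p] ([powR_le_tangent])
    replaces Hoelder's inequality; together they give the power mean inequality
    [norm_sub_le_power_mean].  The only integral that remains is that of the
    continuous function [f] itself.

    The two halves are the same statement with the endpoints exchanged: the
    segment from [alpha] to its midpoint with [beta] is parametrised by
    [alpha + t (beta - alpha)], [0 <= t <= 1/2], where the kernel reads
    [beta (1/2 - t) + alpha t].  [half_segment_estimate] is used once with
    [(alpha, beta) = (a, b)] and once with [(b, a)]. *)

(** * The power mean inequality in terms of increments *)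

(** The graph of the concave function [w |-> w^p] lies below its tangent at [y];
    after division by [y^p] this is Young's inequality for [w / y] and [1]. *)
Lemma powR_le_tangent (R : realType) (p w y : R) :
  0 < p -> p < 1 -> 0 <= w -> 0 < y ->
  w `^ p <= (1 - p) * y `^ p + p * y `^ (p - 1) * w.
Proof.
move=> p_gt0 p_lt1 w_ge0 y_gt0.
have z_ge0 : 0 <= w / y by rewrite divr_ge0// ltW.
have /= := @conjugate_powR R ((w / y) `^ p) 1 p^-1 (1 - p)^-1.
rewrite powR_ge0 ler01 !invr_gt0 !invrK => /(_ isT isT p_gt0).
rewrite subr_gt0 => /(_ p_lt1); rewrite addrCA subrr addr0 => /(_ erefl).
rewrite -powRrM mulfV ?gt_eqF// powRr1// powR1 mul1r mulr1 => young.
have yp := powR_gt0 p y_gt0.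
rewrite -(divfK (lt0r_neq0 y_gt0) w) powRM ?(ltW y_gt0)//.
have -> : p * y `^ (p - 1) * (w / y * y) = p * (w / y) * (y * y `^ (p - 1)).
  by ring.
rewrite mulr_powRB1 ?(ltW y_gt0)//.
by rewrite -mulrDl ler_pM2r// (le_trans young)// addrC [_ * p]mulrC.
Qed.

(** Stands for [|int g'| <= int h'] when [|g'| <= h'], without any integrability
    of [g']: both [h + g] and [h - g] are nondecreasing. *)
Lemma norm_sub_le_antiderivative (R : realType) (x0 x1 : R)
    (g g' h h' : R -> R) :
  x0 <= x1 ->
  {within `[x0, x1], continuous g} -> {within `[x0, x1], continuous h} ->
  (forall x, x \in `]x0, x1[%R -> is_derive x 1 g (g' x)) ->
  (forall x, x \in `]x0, x1[%R -> is_derive x 1 h (h' x)) ->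
  (forall x, x \in `]x0, x1[%R -> `|g' x| <= h' x) ->
  `|g x1 - g x0| <= h x1 - h x0.
Proof.
rewrite le_eqVlt => /predU1P[->|x01]; first by rewrite !subrr normr0.
move=> cg ch dg dh g'h'; rewrite ler_norml; apply/andP; split.
- have [x xI E] := @MVT R (h \+ g) (h' \+ g') _ _ x01
    (fun x xI => @is_deriveD _ _ _ _ _ _ _ _ _ (dh x xI) (dg x xI))
    (fun x => continuousD (ch x) (cg x)).
  have : 0 <= (h' x + g' x) * (x1 - x0).
    rewrite mulr_ge0 ?subr_ge0 ?(ltW x01)//.
    by have := g'h' _ xI; rewrite ler_norml => /andP[+ _]; lra.
  by rewrite -E /=; lra.
- have [x xI E] := @MVT R (h \- g) (h' \- g') _ _ x01
    (fun x xI => @is_deriveB _ _ _ _ _ _ _ _ _ (dh x xI) (dg x xI))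
    (fun x => continuousB (ch x) (cg x)).
  have : 0 <= (h' x - g' x) * (x1 - x0).
    rewrite mulr_ge0 ?subr_ge0 ?(ltW x01)//.
    by have := g'h' _ xI; rewrite ler_norml => /andP[_]; lra.
  by rewrite -E /=; lra.
Qed.

(** Here [K] and [M] play the roles of [int k] and [int k w].  Bounding [w^p] by
    its tangent at [y > 0] makes the bound on [|g'|] a linear combination of [k]
    and [k w], hence the derivative of one of [K] and [M]; the best choice is the
    mean value of [w] for the weight [k], the ratio of the increments of [M] and
    [K]. *)
Lemma norm_sub_le_power_mean (R : realType) (p x0 x1 : R)
    (g g' K k M w : R -> R) :
  0 < p -> p < 1 -> x0 < x1 ->
  {within `[x0, x1], continuous g} ->
  {within `[x0, x1], continuous K} ->
  {within `[x0, x1], continuous M} ->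
  (forall x, x \in `]x0, x1[%R -> is_derive x 1 g (g' x)) ->
  (forall x, x \in `]x0, x1[%R -> is_derive x 1 K (k x)) ->
  (forall x, x \in `]x0, x1[%R -> is_derive x 1 M (k x * w x)) ->
  (forall x, x \in `]x0, x1[%R ->
     [/\ 0 <= k x, 0 <= w x & `|g' x| <= k x * w x `^ p]) ->
  K x0 < K x1 ->
  `|g x1 - g x0| <= (K x1 - K x0) `^ (1 - p) * (M x1 - M x0) `^ p.
Proof.
move=> p0 p1 x01 cg cK cM dg dK dM hyp K01.
have M01 : 0 <= M x1 - M x0.
  have -> : 0 = `|(cst 0 : R -> R) x1 - (cst 0 : R -> R) x0|.
    by rewrite subrr normr0.
  apply: (@norm_sub_le_antiderivative _ _ _ _ (cst 0) M _ (ltW x01) _ cM _ dM)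
    => [|x xI /=].
  - by move=> x; exact: cvg_cst.
  - by have [? ? _] := hyp x xI; rewrite normr0 mulr_ge0.
have bound y : 0 < y ->
  `|g x1 - g x0| <= (1 - p) * y `^ p * (K x1 - K x0)
                    + p * y `^ (p - 1) * (M x1 - M x0).
  move=> y0; set c := (1 - p) * _; set d := p * _.
  have -> : c * (K x1 - K x0) + d * (M x1 - M x0) =
     (c *: K \+ d *: M) x1 - (c *: K \+ d *: M) x0.
    by rewrite /= !scalrfctE /GRing.scale /=; ring.
  apply: (@norm_sub_le_antiderivative R x0 x1 g g' _
    (fun x => c *: k x + d *: (k x * w x)) (ltW x01) cg _ dg).
  - move=> x; apply: continuousD; first exact: continuousZl_tmp (cK x).
    exact: continuousZl_tmp (cM x).
  - move=> x xI; apply: is_deriveD; apply: is_deriveZ; [exact: dK|exact: dM].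
  - move=> x xI; have [k0 w0 /le_trans] := hyp x xI; apply.
    have := powR_le_tangent p0 p1 w0 y0; rewrite -/c -/d => le_w.
    rewrite /GRing.scale /= (_ : _ + _ = k x * (c + d * w x)); last by ring.
    exact: ler_wpM2l.
set D := M x1 - M x0 in M01 bound *; set C := K x1 - K x0 in bound *.
have C0 : 0 < C by rewrite subr_gt0.
move: M01; rewrite le_eqVlt => /predU1P[D0|D0].
  (* The mean of [w] is [0]: a positive [y] with [y^p = |g x1 - g x0| / C]
     already contradicts the bound. *)
  rewrite -D0 powR0 ?gt_eqF// mulr0 leNgt; apply/negP => G0.
  set G := `|_| in bound G0.
  have y0 : 0 < (G / C) `^ p^-1 by rewrite powR_gt0 ?divr_gt0.
  have := bound _ y0; rewrite -D0 mulr0 addr0 -powRrM mulVf ?gt_eqF//.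
  rewrite powRr1 ?divr_ge0 ?(ltW C0) ?(ltW G0)// -mulrA divfK ?gt_eqF//.
  by rewrite leNgt gtr_pMl// gtrBl p0.
have y0 : 0 < D / C by rewrite divr_gt0.
apply: (le_trans (bound _ y0)).
have -> : p * (D / C) `^ (p - 1) * D = p * (D / C) `^ p * C.
  rewrite -(mulr_powRB1 (ltW y0) p0); field.
  by rewrite gt_eqF.
rewrite -mulrDl -mulrDl subrK mul1r powRM ?invr_ge0 ?(ltW C0) ?(ltW D0)//.
rewrite -powR_inv1 ?(ltW C0)// -powRrM mulN1r -mulrA mulrC.
by rewrite [C `^ _ * C]mulrC powRD ?(gt_eqF C0) ?implybT// powRr1 ?(ltW C0).
Qed.

(** * The explicit primitives *)

(** The primitive of [(c + d v) v^s] that vanishes at [0]. *)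
Definition affine_powR_primitive (R : realType) (s c d v : R) : R :=
  c / (s + 1) * v `^ (s + 1) + d / (s + 2) * v `^ (s + 2).

Lemma is_derive_affine_powR_primitive (R : realType) (s c d v : R) :
  0 < s -> 0 < v ->
  is_derive v 1 (affine_powR_primitive s c d) ((c + d * v) * v `^ s).
Proof.
move=> s0 v0.
have s1 : s + 1 != 0 by rewrite gt_eqF// addr_gt0.
have s2 : s + 2 != 0 by rewrite gt_eqF// addr_gt0.
have E1 := is_derive1_powR (s + 1) v0.
have E2 := is_derive1_powR (s + 2) v0.
apply: (@is_derive_eq _ _ _ _ _ _ _ _
  (is_deriveD (is_deriveZ (c / (s + 1)) E1) (is_deriveZ (d / (s + 2)) E2))).
rewrite addrK (_ : s + 2 - 1 = s + 1); last by ring.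
rewrite [v `^ (s + 1)]powRD ?(gt_eqF v0) ?implybT// powRr1 ?(ltW v0)//.
by rewrite /GRing.scale /=; field; rewrite s1 s2.
Qed.

(** Only one-sided at [0]: for [p != 0] the function [x |-> x `^ p] jumps there,
    because its value is [1] at negative arguments. *)
Lemma within_continuous_powR (R : realType) (r p : R) :
  0 < r -> 0 < p -> {within `[0, r], continuous (fun x : R => x `^ p)}.
Proof.
move=> r0 p0.
have cont x : 0 < x -> {for x, continuous (fun x : R => x `^ p)}.
  move=> x0; apply/differentiable_continuous/derivable1_diffP.
  by apply: derivable_powR; rewrite in_itv/= x0.
apply/continuous_within_itvP => //; split.
- by move=> x; rewrite in_itv/= => /andP[/cont].
- by rewrite powR0 ?gt_eqF//; exact: powR_cvg0.
- exact/cvg_at_left_filter/cont.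
Qed.

Lemma within_continuous_affine_powR_primitive (R : realType) (r s c d : R) :
  0 < r -> 0 < s -> {within `[0, r], continuous (affine_powR_primitive s c d)}.
Proof.
move=> r0 s0 x.
have s1 : 0 < s + 1 by rewrite addr_gt0.
have s2 : 0 < s + 2 by rewrite addr_gt0.
have c1 := within_continuous_powR r0 s1 (x := x).
have c2 := within_continuous_powR r0 s2 (x := x).
exact: (continuousD (continuousZl_tmp (k := c / (s + 1)) c1)
                    (continuousZl_tmp (k := d / (s + 2)) c2)).
Qed.

(** The primitive is integrated from a point strictly to the left of [a], so that
    it has a two-sided derivative at the endpoints as well. *)
Lemma exists_primitive (R : realType) (f : R -> R) (c a b : R) :
  c < a -> a < b -> (forall x, c < x -> {for x, continuous f}) ->
  exists F : R -> R,
    (forall x, a <= x <= b -> is_derive x 1 F (f x)) /\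
    \int[@lebesgue_measure R]_(x in `[a, b]) f x = F b - F a.
Proof.
move=> ca ab cf.
pose a' := (c + a) / 2.
have ca' : c < a' by rewrite /a'; lra.
have a'a : a' < a by rewrite /a'; lra.
have within_cf x y : c < x -> {within `[x, y], continuous f}.
  move=> cx; apply: continuous_in_subspaceT => z; rewrite inE/= in_itv/=.
  by move=> /andP[xz _]; apply: cf; exact: lt_le_trans xz.
have intf : (@lebesgue_measure R).-integrable `[a', b + 1] (EFin \o f).
  apply: continuous_compact_integrable; first exact: segment_compact.
  exact: within_cf.
exists (fun x => \int[@lebesgue_measure R]_(t in `[a', x]) f t).
set F := fun x => _.
have dF x : a <= x <= b -> is_derive x 1 F (f x).
  move=> /andP[ax xb].
  have xb1 : x < b + 1 by lra.
  have a'x : a' < x by lra.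
  have [dFx <-] := continuous_FTC1_closed xb1 intf a'x (cf _ (lt_trans ca' a'x)).
  by rewrite derive1E; exact/derivableP.
split => //.
have cF x : a <= x <= b -> {for x, continuous F}.
  move=> xab; apply/differentiable_continuous/derivable1_diffP.
  exact: (@ex_derive _ _ _ _ _ _ _ (dF x xab)).
rewrite /Rintegral (continuous_FTC2 (F := F) ab)//.
- exact: within_cf.
- split.
  + move=> x; rewrite in_itv/= => /andP[/ltW ax /ltW xb].
    by apply: (@ex_derive _ _ _ _ _ _ _ (dF x _)); rewrite ax xb.
  + by apply/cvg_at_right_filter/cF; rewrite lexx ltW.
  + by apply/cvg_at_left_filter/cF; rewrite lexx ltW.
- move=> x; rewrite in_itv/= => /andP[/ltW ax /ltW xb].
  rewrite derive1E; apply: (@derive_val _ _ _ _ _ _ _ (dF x _)).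
  by rewrite ax xb.
Qed.

(** * The estimate on one half of the segment *)

(** The numerator of
      [int_0^(1/2) (beta (1/2 - u) + alpha u) ((1 - u)^s A + u^s B) du]
    over the denominator [2^(s + 2) (s + 1) (s + 2)]. *)
Definition half_weight (R : realType) (s alpha beta A B : R) : R :=
  (alpha * s + alpha + beta) * B
  + (beta * (s * 2 `^ (s + 1) + 1) + alpha * (2 `^ (s + 2) - s - 3)) * A.

(** The coefficient [2^(s + 2) - s - 3] is nonnegative because
    [2^(s + 2) >= 4 >= s + 3]. *)
Lemma half_weight_ge0 (R : realType) (alpha beta s A B : R) :
  0 < alpha -> 0 < beta -> 0 < s -> s <= 1 -> 0 <= A -> 0 <= B ->
  0 <= half_weight s alpha beta A B.
Proof.
rewrite /half_weight => alpha0 beta0 s0 s1 A0 B0.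
have pow_ge4 : 4 <= 2 `^ (s + 2) :> R.
  rewrite (_ : 4 = 2 `^ 2 :> R); last by rewrite powR_mulrn//; ring.
  by apply: ler_powR; lra.
have pow_ge0 := powR_ge0 2 (s + 1).
apply: addr_ge0; apply: mulr_ge0 => //.
  by apply: addr_ge0; [apply: addr_ge0; [apply: mulr_ge0|]|]; exact: ltW.
apply: addr_ge0; apply: mulr_ge0; [exact: ltW| |exact: ltW|lra].
by apply: addr_ge0 => //; apply: mulr_ge0 => //; exact: ltW.
Qed.

(** The power mean inequality for the kernel [k(u) = beta (1/2 - u) + alpha u]
    and the weight [w(u) = (1 - u)^s A + u^s B].  For the part of [k w] that
    carries [A], the kernel is rewritten in the variable [1 - u] as
    [(alpha - beta/2) + (beta - alpha) (1 - u)]. *)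
Lemma norm_sub_half_le (R : realType) (alpha beta A B s p : R) (g g' : R -> R) :
  0 < alpha -> 0 < beta -> 0 <= A -> 0 <= B -> 0 < s -> 0 < p -> p < 1 ->
  {within `[0, 2^-1], continuous g} ->
  (forall u : R, u \in `]0, 2^-1[%R -> is_derive u 1 g (g' u)) ->
  (forall u : R, u \in `]0, 2^-1[%R ->
     `|g' u| <= (beta * (2^-1 - u) + alpha * u)
                * ((1 - u) `^ s * A + u `^ s * B) `^ p) ->
  `|g 2^-1 - g 0| <= ((alpha + beta) / 8) `^ (1 - p)
    * (half_weight s alpha beta A B
       / (2 `^ (s + 2) * (s + 1) * (s + 2))) `^ p.
Proof.
move=> alpha0 beta0 A0 B0 s0 p0 p1 cg dg g'_le.
pose k (u : R) := beta * (2^-1 - u) + alpha * u.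
pose K (u : R) := beta / 2 * u + (alpha - beta) / 2 * u ^+ 2.
pose NA := affine_powR_primitive s (alpha - beta / 2) (beta - alpha).
pose NB := affine_powR_primitive s (beta / 2) (alpha - beta).
pose M (u : R) := B * NB u - A * NA (1 - u).
have h0 : 0 < (2^-1 : R) by rewrite invr_gt0.
have dK (u : R) : is_derive u 1 K (k u).
  by rewrite /K /k; apply: is_derive_eq; rewrite /GRing.scale /=; field.
have dNA (u : R) : u < 1 ->
    is_derive u 1 (fun u => NA (1 - u)) (- (k u * (1 - u) `^ s)).
  move=> u1.
  have d1 : is_derive u 1 (fun u : R => 1 - u) (- 1).
    by apply: is_derive_eq; ring.
  have v0 : 0 < 1 - u by rewrite subr_gt0.
  have d2 :=
    is_derive_affine_powR_primitive (alpha - beta / 2) (beta - alpha) s0 v0.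
  rewrite (_ : - _ = (alpha - beta / 2 + (beta - alpha) * (1 - u))
                     * (1 - u) `^ s * -1).
    exact: (@is_derive1_comp _ NA (fun v => 1 - v) u _ _ d2 d1).
  by rewrite /k; field.
have -> : (alpha + beta) / 8 = K 2^-1 - K 0 by rewrite /K; field.
have -> : half_weight s alpha beta A B
       / (2 `^ (s + 2) * (s + 1) * (s + 2)) = M 2^-1 - M 0.
  have s1 : s + 1 != 0 by rewrite gt_eqF// addr_gt0.
  have s2 : s + 2 != 0 by rewrite gt_eqF// addr_gt0.
  rewrite /half_weight /M /NA /NB /affine_powR_primitive subr0 !powR1.
  rewrite (powR0 s1) (powR0 s2) (_ : 1 - 2^-1 = 2^-1); last by field.
  have half r : (2^-1 : R) `^ r = (2 `^ r)^-1.
    by rewrite -[2^-1]powR_inv1// -powRrM mulN1r powRN.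
  rewrite !half.
  have -> : s + 2 = s + 1 + 1 by ring.
  rewrite (@powRD _ 2 (s + 1) 1) ?pnatr_eq0 ?implybT// powRr1//.
  have := powR_gt0 (s + 1) (ltr0n R 2); move: (2 `^ (s + 1)) => e e0.
  by field; rewrite (gt_eqF e0) s1 -addrA s2.
apply: (@norm_sub_le_power_mean R p 0 2^-1 g g' K k M
  (fun u => (1 - u) `^ s * A + u `^ s * B) p0 p1 h0 cg _ _ dg
  (fun u _ => dK u)).
- apply: derivable_within_continuous => u _.
  exact: (@ex_derive _ _ _ _ _ _ _ (dK u)).
- have c1 : {within `[0, 2^-1], continuous NB}.
    exact: within_continuous_affine_powR_primitive.
  have c2 : {within `[0, 2^-1], continuous (fun u => NA (1 - u))}.
    apply: derivable_within_continuous => u; rewrite in_itv/= => /andP[_ u2].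
    have u1 : u < 1 by lra.
    exact: (@ex_derive _ _ _ _ _ _ _ (dNA u u1)).
  move=> u; exact: (continuousB (continuousZl_tmp (k := B) (c1 u))
                                (continuousZl_tmp (k := A) (c2 u))).
- move=> u; rewrite in_itv/= => /andP[u0 u2].
  have d1 := is_derive_affine_powR_primitive (beta / 2) (alpha - beta) s0 u0.
  have u1 : u < 1 by lra.
  have d2 := dNA u u1.
  apply: (@is_derive_eq _ _ _ _ _ _ _ _
    (is_deriveB (is_deriveZ B d1) (is_deriveZ A d2))).
  by rewrite /GRing.scale /= /k; field.
- move=> u uI; split; last exact: g'_le.
    move: uI; rewrite in_itv/= => /andP[u0 u2].
    by rewrite addr_ge0// mulr_ge0//; lra.
  by rewrite addr_ge0// mulr_ge0// powR_ge0.
- by rewrite -subr_gt0 /K; lra.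
Qed.

(** The quantity under the absolute value is the kernel integral on the half next
    to [alpha], integrated by parts and divided by the length of the segment;
    since [beta - alpha] is the signed length, both halves take the same form.
    It is the increment over [[0, 1/2]], along the segment, of
    [G(x) = (beta - alpha)^-1 ((alpha + beta/2 - x) f(x) + F(x))]. *)
Lemma half_segment_estimate (R : realType) (f F : R -> R) (alpha beta s q : R) :
  0 < alpha -> 0 < beta -> alpha != beta -> 0 < s -> 1 < q ->
  (forall t : R, 0 <= t <= 1 ->
     let x := alpha + t * (beta - alpha) in
     [/\ derivable f x 1, is_derive x 1 F (f x) &
         `|f^`() x| `^ q
           <= (1 - t) `^ s * `|f^`() alpha| `^ q
              + t `^ s * `|f^`() beta| `^ q]) ->
  `|(beta - alpha)^-1 * (alpha / 2 * f ((alpha + beta) / 2) - beta / 2 * f alpha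
                    + (F ((alpha + beta) / 2) - F alpha))|
  <= ((alpha + beta) / 8) `^ (1 - q^-1)
    * (half_weight s alpha beta (`|f^`() alpha| `^ q) (`|f^`() beta| `^ q)
       / (2 `^ (s + 2) * (s + 1) * (s + 2))) `^ q^-1.
Proof.
move=> alpha0 beta0 alphabeta s0 q1 hyp.
have q0 : 0 < q by lra.
have de0 : beta - alpha != 0 by rewrite subr_eq0 eq_sym.
pose f' : R -> R := (f^`())%classic.
pose h (t : R) := alpha + t * (beta - alpha).
pose G (x : R) := (beta - alpha)^-1 * ((alpha + beta / 2 - x) * f x + F x).
have dh (t : R) : is_derive t 1 h (beta - alpha).
  by apply: is_derive_eq; rewrite /GRing.scale /=; ring.
have dg (t : R) : 0 <= t <= 1 ->
    is_derive t 1 (G \o h) ((alpha + beta / 2 - h t) * f' (h t)).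
  move=> /hyp[df dF _].
  have dfx : is_derive (h t) 1 f (f' (h t)).
    by rewrite /f' derive1E; exact/derivableP.
  have dG : is_derive (h t) 1 G
      ((beta - alpha)^-1 * ((alpha + beta / 2 - h t) * f' (h t))).
    apply: is_derive_eq; rewrite /GRing.scale /=; ring.
  rewrite (_ : _ * _ = (beta - alpha)^-1 * ((alpha + beta / 2 - h t) * f' (h t))
                        * (beta - alpha)); last by field.
  exact: is_derive1_comp.
have -> : (beta - alpha)^-1
    * (alpha / 2 * f ((alpha + beta) / 2) - beta / 2 * f alpha
       + (F ((alpha + beta) / 2) - F alpha)) = (G \o h) 2^-1 - (G \o h) 0.
  have mE : alpha + 2^-1 * (beta - alpha) = (alpha + beta) / 2 by field.
  rewrite /G /= /h mul0r addr0 mE.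
  by field.
have p0 : 0 < q^-1 by rewrite invr_gt0.
have p1 : q^-1 < 1 by rewrite invf_lt1.
apply: (@norm_sub_half_le _ alpha beta _ _ s q^-1 (G \o h)
         (fun t => (alpha + beta / 2 - h t) * f' (h t)) alpha0 beta0
         (powR_ge0 _ _) (powR_ge0 _ _) s0 p0 p1).
- apply: derivable_within_continuous => t; rewrite in_itv/= => /andP[t0 t1].
  by apply: (@ex_derive _ _ _ _ _ _ _ (dg t _)); lra.
- by move=> t; rewrite in_itv/= => /andP[t0 t1]; apply: dg; lra.
- move=> t; rewrite in_itv/= => /andP[t0 t1].
  have t01 : 0 <= t <= 1 by lra.
  have t2 : 0 <= 2^-1 - t by lra.
  have [_ _] := hyp t t01; rewrite -/(h t) -/f' => f'_le.
  have -> : alpha + beta / 2 - h t = beta * (2^-1 - t) + alpha * t.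
    by rewrite /h; field.
  have k0 : 0 <= beta * (2^-1 - t) + alpha * t.
    exact: (addr_ge0 (mulr_ge0 (ltW beta0) t2) (mulr_ge0 (ltW alpha0) (ltW t0))).
  rewrite normrM (ger0_norm k0); apply: (ler_wpM2l k0).
  rewrite -[leLHS](powRr1 (normr_ge0 _)).
  rewrite -[X in _ `^ X <= _](mulfV (lt0r_neq0 q0)) powRrM.
  apply: ge0_ler_powR; rewrite ?nnegrE; [exact: ltW|exact: powR_ge0| |].
    by apply: addr_ge0; apply: mulr_ge0; exact: powR_ge0.
  exact: f'_le.
Qed.

(** The mass [(a + b)/8] of the kernel is [2^-2] times the arithmetic mean, and
    [(2^-2)^(1 - 1/q) = ((2^(2 q - 2))^(1/q))^-1] merges with the denominator
    [2^(s + 2)]. *)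
Lemma half_bound_arith_mean (R : realType) (a b s q S : R) :
  0 < a -> 0 < b -> 0 < s -> 0 < q -> 0 <= S ->
  ((a + b) / 8) `^ (1 - q^-1)
    * (S / (2 `^ (s + 2) * (s + 1) * (s + 2))) `^ q^-1
  = arith_mean a b `^ (1 - q^-1)
    / (2 `^ (2 * q + s) * (s + 1) * (s + 2)) `^ q^-1 * S `^ q^-1.
Proof.
move=> a0 b0 s0 q0 S0; set p := q^-1.
have s1 : 0 < s + 1 by lra.
have s2 : 0 < s + 2 by lra.
have E r : 0 < 2 `^ r * (s + 1) * (s + 2) by rewrite !mulr_gt0 ?powR_gt0.
have A0 : 0 < arith_mean a b by rewrite /arith_mean; lra.
have -> : (a + b) / 8 = arith_mean a b * 2 `^ (- 2).
  by rewrite powRN powR_mulrn// /arith_mean; field.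
have -> : 2 `^ (2 * q + s) * (s + 1) * (s + 2)
        = 2 `^ (2 * q - 2) * (2 `^ (s + 2) * (s + 1) * (s + 2)).
  rewrite !mulrA -powRD ?pnatr_eq0 ?implybT//.
  by congr (2 `^ _ * _ * _); ring.
have := E (s + 2); move: (2 `^ (s + 2) * _ * _) => X X0.
have XV : X^-1 `^ p = (X `^ p)^-1.
  by rewrite -powR_inv1 ?(ltW X0)// -powRrM mulN1r powRN.
have pw4 : (2 `^ (- 2)) `^ (1 - p) = ((2 `^ (2 * q - 2)) `^ p)^-1 :> R.
  rewrite -!powRrM -powRN; congr (_ `^ _).
  by rewrite /p; field; rewrite gt_eqF.
rewrite (powRM _ (ltW A0) (powR_ge0 _ _)) powRM ?invr_ge0 ?(ltW X0)//.
rewrite (powRM _ (powR_ge0 _ _) (ltW X0)) XV pw4 invfM.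
by ring.
Qed.

(** * The inequality *)

Theorem theorem12 (R : realType) (f : R -> R) (a b s q : R)
  (f_diff : forall x : R, 0 < x -> derivable f x 1)
  (a_gt0 : 0 < a) (a_lt_b : a < b)
  (f'_L1 : (@lebesgue_measure R).-integrable `[a, b] (EFin \o f^`()))
  (s_gt0 : 0 < s) (s_le1 : s <= 1) (q_gt1 : 1 < q)
  (f'_conv : s_convex_second s `[a, b] (fun x => `|f^`() x| `^ q)) :
  `| (b - a)^-1 * (\int[@lebesgue_measure R]_(x in `[a, b]) f x)
     - 2^-1 * ((b * f a - a * f b) / (b - a) + f ((a + b) / 2)) |
  <= arith_mean a b `^ (1 - q^-1)
       / (2 `^ (2 * q + s) * (s + 1) * (s + 2)) `^ q^-1
     * ( ((a * s + a + b) * `|f^`() b| `^ q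
          + (b * (s * 2 `^ (s + 1) + 1) + a * (2 `^ (s + 2) - s - 3))
            * `|f^`() a| `^ q) `^ q^-1
       + ((b * s + b + a) * `|f^`() a| `^ q
          + (a * (s * 2 `^ (s + 1) + 1) + b * (2 `^ (s + 2) - s - 3))
            * `|f^`() b| `^ q) `^ q^-1 ).
Proof.
have q0 : 0 < q by lra.
have b0 : 0 < b by exact: lt_trans a_lt_b.
have cf x : 0 < x -> {for x, continuous f}.
  by move=> x0; apply/differentiable_continuous/derivable1_diffP/f_diff.
have [F [dF ->]] := exists_primitive a_gt0 a_lt_b cf.
have hyp (x t : R) : 0 <= t <= 1 -> x = a + t * (b - a) ->
    [/\ derivable f x 1, is_derive x 1 F (f x) &
         `|f^`() x| `^ q
           <= (1 - t) `^ s * `|f^`() a| `^ q + t `^ s * `|f^`() b| `^ q].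
  move=> t01 xE; have xab : a <= x <= b by rewrite xE; nra.
  split; [by apply: f_diff; lra | exact: dF |].
  have [_ conv] := f'_conv.
  rewrite [leRHS]addrC xE (_ : a + _ = t * b + (1 - t) * a); last by ring.
  by apply: conv; rewrite //= in_itv/= lexx ltW.
have le1 := @half_segment_estimate R f F a b s q a_gt0 b0
  (negbT (lt_eqF a_lt_b)) s_gt0 q_gt1 (fun t t01 => hyp _ t t01 erefl).
(* Exchanging [a] and [b] exchanges [t] and [1 - t], which preserves the bound
   on [f']. *)
have hyp' (t : R) : 0 <= t <= 1 -> let x := b + t * (a - b) in
    [/\ derivable f x 1, is_derive x 1 F (f x) &
         `|f^`() x| `^ q
           <= (1 - t) `^ s * `|f^`() b| `^ q + t `^ s * `|f^`() a| `^ q].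
  move=> t01 x; have xE : x = a + (1 - t) * (b - a) by rewrite /x; ring.
  have t01' : 0 <= 1 - t <= 1 by lra.
  have [df dFx f'_le] := hyp x (1 - t) t01' xE.
  split; [exact: df|exact: dFx|].
  by rewrite [leRHS]addrC; move: f'_le; rewrite subKr; exact.
have le2 := @half_segment_estimate R f F b a s q b0 a_gt0
  (negbT (gt_eqF a_lt_b)) s_gt0 q_gt1 hyp'.
rewrite half_bound_arith_mean// in le1;
  last by apply: half_weight_ge0 => //; exact: powR_ge0.
rewrite half_bound_arith_mean// in le2;
  last by apply: half_weight_ge0 => //; exact: powR_ge0.
have meanC : arith_mean b a = arith_mean a b by rewrite /arith_mean addrC.
rewrite meanC /half_weight in le2; rewrite /half_weight in le1.
rewrite [leRHS]mulrDr.
have d0 : b - a != 0 by rewrite subr_eq0 gt_eqF.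
have d0' : a - b != 0 by rewrite subr_eq0 lt_eqF.
apply: (le_trans _ (lerD le1 le2)); apply: (le_trans _ (ler_normD _ _)).
rewrite le_eqVlt; apply/orP; left; apply/eqP; congr `|_|.
rewrite [(b + a) / 2](_ : _ = (a + b) / 2); last by rewrite addrC.
by field; rewrite d0 d0'.
Qed.
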